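(* Let $G$ be a finite simple connected graph with vertex set $V(G)=\{x_1,\dots,x_n\}$, let $\mathbb{K}$ be a field, and suppose that the complement $\overline{G}$ is a $(d_1,d_2,\dots,d_q)$-tree for a non-increasing sequence $(d_1,d_2,\dots,d_q)$ of positive integers. Then $$\operatorname{pdim}\mathbb{K}[\Delta_G]=\max_{1\leq i\leq n}\{\deg_G(x_i)\}.$$
   Context: The complement $\overline{G}$ has the same vertex set as $G$, and two distinct vertices are adjacent in $\overline{G}$ iff they are not adjacent in $G$. $\mathcal{K}_r$ denotes the complete graph on $r$ vertices. $(d_1,\dots,d_q)$-trees: let $(d_1,d_2,\dots,d_q)$ be a non-increasing sequence of positive integers. A $(d_1,d_2,\dots,d_q)$-tree is a graph $H$ constructed inductively as follows: $H_1=\mathcal{K}_{d_1}$; for $2\le i\le q$, $H_i=H_{i-1}\bigcup_{\mathcal{K}_{d_i-1}}\mathcal{K}_{d_i}$, i.e. $H_i$ is obtained from $H_{i-1}$ by gluing a complete graph on $d_i$ vertices along a complete subgraph of $H_{i-1}$ on $d_i-1$ vertices (equivalently, adding one new vertex adjacent exactly to the vertices of a clique of $H_{i-1}$ of size $d_i-1$; when $d_i=1$ the new vertex is isolated in $H_i$); and $H=H_q$. $R=\mathbb{K}[x_1,\dots,x_n]$ is the polynomial ring over $\mathbb{K}$ with variables the vertices of $G$; $I(G)=(x_ix_j\mid \{x_i,x_j\}\in E(G))\subseteq R$ is the edge ideal; $\Delta_G$ is the independence complex of $G$ (the simplicial complex of all independent sets), whose Stanley--Reisner ring is $\mathbb{K}[\Delta_G]=R/I(G)$.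 $\operatorname{pdim}\mathbb{K}[\Delta_G]$ is the projective dimension of $R/I(G)$ as an $R$-module, i.e. the length of its minimal graded free resolution over $R$. $\deg_G(x)$ is the number of neighbours of $x$ in $G$. *)

(* Defs.v *)
From HB Require Import structures.
From mathcomp Require Import all_boot all_order all_algebra ring_quotient.
From mathcomp Require Import boolp.
From mathcomp Require Import mpoly.

Set Implicit Arguments.
Unset Strict Implicit.
Unset Printing Implicit Defensive.
Import GRing.Theory.
Local Open Scope ring_scope.
Local Open Scope quotient_scope.

Section ProjectiveDimension.
Variable R : nzRingType.

Definition surjective_lin (A B : lmodType R) (g : {linear A -> B}) : Prop :=
  forall b : B, exists a : A, g a = b.

Definition projective (P : lmodType R) : Prop :=
  forall (A B : lmodType R) (g : {linear A -> B}) (f : {linear P -> B}),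
    surjective_lin g -> exists h : {linear P -> A}, forall p, g (h p) = f p.

Definition exact_at (A B C : lmodType R)
    (f : {linear A -> B}) (g : {linear B -> C}) : Prop :=
  forall b : B, g b = 0 <-> exists a : A, f a = b.

(* ... -> P_2 -> P_1 -> P_0 -> M -> 0, with [res_diff i : P_(i+1) -> P_i]. *)
Record projective_resolution (M : lmodType R) := ProjectiveResolution {
  res_mod :> nat -> lmodType R;
  res_diff : forall i, {linear res_mod i.+1 -> res_mod i};
  res_aug : {linear res_mod 0%N -> M};
  res_projective : forall i, projective (res_mod i);
  res_aug_surj : surjective_lin res_aug;
  res_exact0 : exact_at (res_diff 0) res_aug;
  res_exactS : forall i, exact_at (res_diff i.+1) (res_diff i)
}.

Definition length_le (M : lmodType R) (P : projective_resolution M) (d : nat) :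
  Prop := forall i, (d < i)%N -> forall x : P i, x = 0.

Definition pdim_le (M : lmodType R) (d : nat) : Prop :=
  exists P : projective_resolution M, length_le P d.

(* [pdim_eq M d]: d is the least length of a projective resolution of M; no d
   satisfies this when the projective dimension of M is infinite. *)
Definition pdim_eq (M : lmodType R) (d : nat) : Prop :=
  pdim_le M d /\ forall d', pdim_le M d' -> (d <= d')%N.

End ProjectiveDimension.

Section IdealQuotient.
Variables (R : comNzRingType) (S : R -> Prop).

Definition in_ideal (x : R) : Prop :=
  exists (k : nat) (c g : 'I_k -> R),
    (forall i, S (g i)) /\ x = \sum_(i < k) c i * g i.

Definition ideal_gen : R -> bool := fun x => `[< in_ideal x >].

Lemma in_idealP x : reflect (in_ideal x) (x \in ideal_gen).
Proof. exact: asboolP. Qed.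

Lemma in_ideal0 : in_ideal 0.
Proof.
exists 0%N, (fun=> 0), (fun=> 0); split; first by case.
by rewrite big_ord0.
Qed.

Lemma in_ideal_gen x : S x -> in_ideal x.
Proof.
move=> Sx; exists 1%N, (fun=> 1), (fun=> x); split=> //.
by rewrite big_ord1 mul1r.
Qed.

Lemma in_idealM a x : in_ideal x -> in_ideal (a * x).
Proof.
case=> k [c [g [Sg ->]]]; exists k, (fun i => a * c i), g; split=> //.
by rewrite mulr_sumr; apply: eq_bigr => i _; rewrite mulrA.
Qed.

Lemma in_idealD x y : in_ideal x -> in_ideal y -> in_ideal (x + y).
Proof.
case=> k [c [g [Sg ->]]] [l [d [h [Sh ->]]]].
pose glue (u : 'I_k -> R) (v : 'I_l -> R) (i : 'I_(k + l)) :=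
  match split i with inl j => u j | inr j => v j end.
exists (k + l)%N, (glue c d), (glue g h); split.
  by move=> i; rewrite /glue; case: split.
have splitl j : split (lshift l j) = inl j :> 'I_k + 'I_l.
  exact: (unsplitK (inl j)).
have splitr j : split (rshift k j) = inr j :> 'I_k + 'I_l.
  exact: (unsplitK (inr j)).
by rewrite big_split_ord /=; congr (_ + _); apply: eq_bigr => j _;
  rewrite /glue ?splitl ?splitr.
Qed.

Fact ideal_gen_zmod_closed : zmod_closed ideal_gen.
Proof.
split; first exact/in_idealP/in_ideal0.
move=> x y /in_idealP xI /in_idealP yI; apply/in_idealP.
by rewrite -mulN1r; apply/in_idealD/in_idealM.
Qed.
HB.instance Definition _ :=
  GRing.isZmodClosed.Build R ideal_gen ideal_gen_zmod_closed.

(* [{ideal_quot _}] carries no module structure over the base ring, and its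
   ring structure requires a proper ideal. *)
Definition quot_by : Type :=
  {ideal_quot (GRing.ZmodClosed.clone R ideal_gen _)}.
HB.instance Definition _ := GRing.Zmodule.on quot_by.
HB.instance Definition _ := EqQuotient.on quot_by.

Definition quot_scale (a : R) (x : quot_by) : quot_by :=
  \pi_quot_by (a * repr x).

Lemma quot_scale_pi a x : quot_scale a (\pi_quot_by x) = \pi_quot_by (a * x).
Proof.
apply/eqP; rewrite -Quotient.idealrBE -mulrBr.
apply/in_idealP/in_idealM/in_idealP.
by rewrite Quotient.idealrBE reprK.
Qed.

Lemma quot_piD x y :
  \pi_quot_by (x + y) = \pi_quot_by x + \pi_quot_by y :> quot_by.
Proof. by rewrite !piE. Qed.

Fact quot_scaleA a b x : quot_scale a (quot_scale b x) = quot_scale (a * b) x.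
Proof. by rewrite -[x]reprK (quot_scale_pi b) !quot_scale_pi mulrA. Qed.
Fact quot_scale1 : left_id 1 quot_scale.
Proof. by move=> x; rewrite -[x]reprK quot_scale_pi mul1r. Qed.
Fact quot_scaleDr : right_distributive quot_scale +%R.
Proof.
move=> a x y; rewrite -[x]reprK -[y]reprK.
by rewrite -quot_piD !quot_scale_pi -quot_piD mulrDr.
Qed.
Fact quot_scaleDl x : {morph quot_scale^~ x : a b / a + b}.
Proof.
by move=> a b; rewrite -[x]reprK !quot_scale_pi -quot_piD mulrDl.
Qed.
HB.instance Definition _ := GRing.Zmodule_isLmodule.Build R quot_by
  quot_scaleA quot_scale1 quot_scaleDr quot_scaleDl.

Lemma quot_pi_eq0 (x : R) : \pi_quot_by x = 0 :> quot_by <-> in_ideal x.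
Proof.
have -> : (0 : quot_by) = \pi_quot_by 0.
  by rewrite (raddf0 \pi_quot_by).
split=> [/eqP|xI]; first by rewrite -Quotient.idealrBE subr0 => /in_idealP.
by apply/eqP; rewrite -Quotient.idealrBE subr0; apply/in_idealP.
Qed.

End IdealQuotient.

Section Graphs.
Variable T : finType.
Implicit Types (e : rel T) (A B S : {set T}).

Definition connected_graph e : Prop := forall x y, connect e x y.

Definition compl_graph e : rel T := [rel x y | (x != y) && ~~ e x y].

Definition degree e (x : T) : nat := #|[set y | e x y]|.

Definition clique e A : bool :=
  [forall x in A, forall y in A, (x != y) ==> e x y].

(* [tree_on e S d]: the subgraph of e induced on S is a (d_1, ..., d_q)-tree.
   In the gluing step the subgraph on A :|: B is the union of those on A and on
   B, along their common complete subgraph on A :&: B. *)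
Inductive tree_on e : {set T} -> seq nat -> Prop :=
| TreeBase A d : clique e A -> #|A| = d -> tree_on e A [:: d]
| TreeGlue A B ds d :
    tree_on e A ds ->
    clique e B -> #|B| = d -> #|A :&: B| = d.-1 ->
    (forall x y, x \in A :\: B -> y \in B :\: A -> ~~ e x y) ->
    tree_on e (A :|: B) (rcons ds d).

Definition is_tree e (ds : seq nat) : Prop := tree_on e [set: T] ds.

Definition independence_complex e : {set {set T}} :=
  [set F : {set T} | [forall x in F, forall y in F, ~~ e x y]].

End Graphs.

Section StanleyReisner.
Variables (n : nat) (K : fieldType).
Implicit Types (D : {set {set 'I_n}}) (e : rel 'I_n).

Definition nonface_monomial D (f : {mpoly K[n]}) : Prop :=
  exists F : {set 'I_n}, F \notin D /\ f = \prod_(i in F) 'X_i.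

Definition stanley_reisner_ring D : lmodType {mpoly K[n]} :=
  quot_by (nonface_monomial D).

Definition edge_monomial e (f : {mpoly K[n]}) : Prop :=
  exists i j : 'I_n, e i j /\ f = 'X_i * 'X_j.

Lemma in_ideal_sub (R : comNzRingType) (S S' : R -> Prop) x :
  (forall y, S y -> in_ideal S' y) -> in_ideal S x -> in_ideal S' x.
Proof.
move=> SS' [k [c [g [Sg ->]]]].
by elim/big_ind: _ => [|u v|i _];
  [exact: in_ideal0 | exact: in_idealD | exact/in_idealM/SS'].
Qed.

Lemma stanley_reisner_edge_ideal e (f : {mpoly K[n]}) :
  ssrbool.symmetric e -> irreflexive e ->
  in_ideal (nonface_monomial (independence_complex e)) f <->
  in_ideal (edge_monomial e) f.
Proof.
move=> es ei; split; apply: in_ideal_sub => {}f.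
- case=> F [FD ->]; move: FD; rewrite inE negb_forall_in.
  case/exists_inP=> i iF; rewrite negb_forall_in.
  case/exists_inP=> j jF /negPn eij.
  have ji : j != i by apply: contraTneq eij => ->; rewrite ei.
  rewrite (bigD1 i) //= (bigD1 j) ?jF //= mulrA mulrC.
  by apply/in_idealM/in_ideal_gen; exists i, j.
- case=> i [j [eij ->]]; apply: in_ideal_gen; exists [set i; j]; split.
    rewrite inE negb_forall_in; apply/exists_inP; exists i; rewrite ?set21 //.
    by rewrite negb_forall_in; apply/exists_inP; exists j; rewrite ?set22 ?eij.
  have ij : i != j by apply: contraTneq eij => ->; rewrite ei.
  by rewrite big_setU1 ?inE //= big_set1.
Qed.

End StanleyReisner.

(* Main.v *)
Require Import Defs.
From HB Require Import structures.
From mathcomp Require Import all_boot all_order all_algebra.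
From mathcomp Require Import boolp.
From mathcomp Require Import mpoly freeg.

(** Let [R] be the polynomial ring and [H] the complement of [G].  The
    independence complex of [G] is the clique complex of [H], and if
    [(d_1, ..., d_q)] is the sequence of the tree [H], both sides of the equality
    turn out to be [n - d_q].  The proof is a circle of three inequalities.

    pdim <= n - d_q.  For a complex [D] and a vertex [v], multiplication by [x_v]
    gives an exact sequence

      0 -> K[star v D] -> K[D] -> K[deletion v D] -> 0

    ([star_deletion_exact]), where the star is the colon ideal by [x_v] and the
    deletion is what remains after killing [x_v].  When a clique [B] is glued to
    [A] along all but one vertex [v] of [B], the star of [v] is the full simplex on
    [B] and the deletion of [v] is the clique complex of [A].  The horseshoe lemma
    then bounds pdim by the larger of [n - d_q], for the simplex on [B], and the
    bound [n - d_(q-1)] obtained for [A]; as the sequence does not increase, this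
    is [n - d_q] ([tree_pdim]).  The bound [n - #|C|] for the simplex on [C] comes
    from the same exact sequence, used to delete the vertices outside [C] one at
    a time: deleting a cone point raises pdim by at most one.

    n - d_q <= max deg.  The last vertex to be glued has [d_q - 1] neighbours in
    [H], hence [n - d_q] neighbours in [G]; if nothing is glued, [n - d_q] is zero
    ([tree_le_max_degree]).

    max deg <= pdim, for every graph.  In [R / I(G)] the class of [x_v] is nonzero
    and is killed by [x_j] for each neighbour [j] of [v].  A nonzero element killed
    by [h] distinct variables yields a nonzero class in
    [Tor_h (M, R / (x_1, ..., x_h))], so no projective resolution of [M] vanishes
    in degree [h] ([annihilator_pdim]).  Here [Tor] is handled by chasing elements
    in an arbitrary resolution modulo the variables; the only property of
    projective modules that this needs is that the variables form a regular
    sequence on them ([projective_var_regular]). *)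

Set Implicit Arguments.
Unset Strict Implicit.
Unset Printing Implicit Defensive.
Import GRing.Theory.

(** * Modules of bounded projective dimension *)

Section Kernel.
Local Open Scope ring_scope.
Variables (R : nzRingType) (F M : lmodType R) (g : {linear F -> M}).

Definition lin_ker : {pred F} := fun x => g x == 0.

Fact lin_ker_submod_closed : submod_closed lin_ker.
Proof.
split; first by rewrite unfold_in linear0.
move=> a x y; rewrite !unfold_in linearP => /eqP-> /eqP->.
by rewrite scaler0 addr0.
Qed.

HB.instance Definition _ :=
  GRing.isSubmodClosed.Build R F lin_ker lin_ker_submod_closed.

Record ker_type := KerType { ker_val :> F; _ : ker_val \in lin_ker }.
HB.instance Definition _ := [isSub for ker_val].
HB.instance Definition _ := [Choice of ker_type by <:].
HB.instance Definition _ := [SubChoice_isSubLmodule of ker_type by <:].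

Lemma kernel_exists :
  exists (N : lmodType R) (k : {linear N -> F}), injective k /\ exact_at k g.
Proof.
exists ker_type, \val; split; first exact: val_inj.
move=> x; split=> [/eqP gx0|[[y gy0] <-]]; last exact/eqP.
by exists (KerType gx0).
Qed.

End Kernel.

Section Homological.
Local Open Scope ring_scope.
Variable R : nzRingType.
Implicit Types M N F X : lmodType R.

Lemma linear_of M N (f : M -> N) :
  linear f -> exists h : {linear M -> N}, h =1 f.
Proof.
move=> lf.
pose h : {linear M -> N} := HB.pack f (GRing.isLinear.Build R M N *:%R f lf).
by exists h.
Qed.

(** Corestriction: it replaces the inverse of [i] on its image, which is how the
    maps between kernels in the diagrams below are obtained. *)
Lemma factor_injective X N F (i : {linear N -> F}) (f : {linear X -> F}) :
  injective i -> (forall x, exists a, i a = f x) ->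
  exists h : {linear X -> N}, forall x, i (h x) = f x.
Proof.
move=> i_inj /choice[h ih].
have [|h' h'E] := linear_of (f := h).
  by move=> a x y; apply: i_inj; rewrite linearP !ih linearP.
by exists h' => x; rewrite h'E.
Qed.

Lemma projective_pair M N :
  projective M -> projective N -> projective (M * N)%type.
Proof.
move=> Mproj Nproj A B g f g_surj.
have [|f1 f1E] := linear_of (f := fun x : M => f (x, 0)).
  move=> a x y /=; rewrite -linearP; congr (f _).
  by congr (_, _); rewrite /= scaler0 addr0.
have [|f2 f2E] := linear_of (f := fun y : N => f (0, y)).
  move=> a x y /=; rewrite -linearP; congr (f _).
  by congr (_, _); rewrite /= scaler0 addr0.
have [h1 h1E] := Mproj _ _ g f1 g_surj.
have [h2 h2E] := Nproj _ _ g f2 g_surj.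
have [|h hE] := linear_of (f := fun z : M * N => h1 z.1 + h2 z.2).
  by move=> a x y /=; rewrite !linearP scalerDr addrACA.
exists h => -[x y]; rewrite hE linearD h1E h2E f1E f2E -linearD /=.
by congr (f (_, _)); rewrite /= ?addr0 ?add0r.
Qed.

Lemma projective_zero M : (forall x : M, x = 0) -> projective M.
Proof.
move=> M0 A B g f _; exists \0 => x.
by rewrite (M0 x) !linear0.
Qed.

Definition short_exact M' M M''
    (i : {linear M' -> M}) (p : {linear M -> M''}) : Prop :=
  [/\ injective i, exact_at i p & surjective_lin p].

(** [pdim_lt d M] says that [M] has projective dimension less than [d], by
    successive syzygies.  Starting the count at the zero module, rather than at
    projective modules, makes the base cases of the inductions trivial: no
    splitting argument is needed for projective modules. *)
Fixpoint pdim_lt (d : nat) (M : lmodType R) : Prop :=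
  if d is d'.+1 then
    exists (F N : lmodType R) (i : {linear N -> F}) (g : {linear F -> M}),
      [/\ projective F, short_exact i g & pdim_lt d' N]
  else forall x : M, x = 0.

Lemma pdim_ltS d M : pdim_lt d M -> pdim_lt d.+1 M.
Proof.
elim: d M => [|d IHd] M.
  move=> /= M0; exists M, M, idfun, idfun.
  split=> //; first exact: projective_zero.
  split=> // b; last by exists b.
  by split=> [_|_]; [exists b | exact: M0].
case=> F [N [i [g [Fproj ex /IHd Nd]]]].
by exists F, N, i, g.
Qed.

Lemma pdim_lt_leq d d' M : (d <= d')%N -> pdim_lt d M -> pdim_lt d' M.
Proof.
by move/subnK <-; elim: (d' - d)%N => //= k IHk /IHk /pdim_ltS.
Qed.

Lemma pdim_lt_projective M : projective M -> pdim_lt 1 M.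
Proof.
move=> Mproj.
have [N [k [k_inj k_ex]]] := @kernel_exists R M M idfun.
exists M, N, k, idfun; split=> //.
  by split=> // b; exists b.
move=> x; apply: k_inj; rewrite linear0.
by apply/(k_ex (k x)); exists x.
Qed.

(** Projective modules [F'] onto [M'] and [F''] onto [M''] give [F' * F''] onto [M],
    because the second surjection lifts to [M]; the three kernels form again a
    short exact sequence. *)
Lemma horseshoe d M' M M'' (i : {linear M' -> M}) (p : {linear M -> M''}) :
  short_exact i p -> pdim_lt d M' -> pdim_lt d M'' -> pdim_lt d M.
Proof.
elim: d M' M M'' i p => [|d IHd] M' M M'' i p [i_inj i_ex p_surj].
  move=> /= M'0 M''0 x.
  by have /i_ex[a <-] := M''0 (p x); rewrite (M'0 a) linear0.
case=> F' [N' [i' [q' [F'proj [i'_inj i'_ex q'_surj] N'd]]]].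
case=> F'' [N'' [i'' [q'' [F''proj [i''_inj i''_ex q''_surj] N''d]]]].
have [s sE] := F''proj _ _ p q'' p_surj.
have ip0 a : p (i a) = 0 by apply/i_ex; exists a.
have iq0 a : q' (i' a) = 0 by apply/i'_ex; exists a.
have iq''0 a : q'' (i'' a) = 0 by apply/i''_ex; exists a.
have [|q qE] := linear_of (f := fun z : F' * F'' => i (q' z.1) + s z.2).
  by move=> a x y /=; rewrite !linearP scalerDr addrACA.
have [N [k [k_inj k_ex]]] := kernel_exists q.
have kq0 c : q (k c) = 0 by apply/k_ex; exists c.
have [|j' j'E] := linear_of (f := fun x : N' => (i' x, 0) : F' * F'').
  move=> a x y; rewrite linearP; congr (_, _).
  by rewrite /= scaler0 addr0.
have [|u uE] := factor_injective (f := j') k_inj.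
  by move=> x; apply/k_ex; rewrite j'E qE /= iq0 !linear0 addr0.
have [|p2 p2E] := linear_of (f := fun c : N => (k c).2).
  by move=> a x y; rewrite linearP.
have [|w wE] := factor_injective (f := p2) i''_inj.
  move=> c; apply/i''_ex; rewrite p2E -sE.
  by have /(congr1 p) := kq0 c; rewrite qE linearD ip0 add0r linear0.
exists (F' * F'')%type, N, k, q; split; first exact: projective_pair.
  split=> // m.
  have [y yE] := q''_surj (p m).
  have /i_ex[a aE] : p (m - s y) = 0 by rewrite linearB sE yE subrr.
  have [x xE] := q'_surj a.
  by exists (x, y); rewrite qE /= xE aE subrK.
apply: (IHd _ _ _ u w) => //; split.
- move=> x y /(congr1 k); rewrite !uE !j'E => -[]; exact: i'_inj.
- move=> c; split=> [wc0|[x <-]]; last first.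
    by apply: i''_inj; rewrite wE p2E uE j'E linear0.
  have c2 : (k c).2 = 0 by rewrite -p2E -wE wc0 linear0.
  have /i'_ex[x xE] : q' (k c).1 = 0.
    by apply: i_inj; have := kq0 c; rewrite qE c2 !linear0 addr0.
  exists x; apply: k_inj; rewrite uE j'E xE -c2.
  by case: (k c).
- move=> y.
  have /i_ex[a aE] : p (s (i'' y)) = 0 by rewrite sE iq''0.
  have [x xE] := q'_surj (- a).
  have /k_ex[c cE] : q (x, i'' y) = 0.
    by rewrite qE /= xE linearN aE addNr.
  by exists c; apply: i''_inj; rewrite wE p2E cE.
Qed.

(** A projective [F] onto [M] is also onto [M''], and the two kernels [N] and [N2]
    fit in [0 -> N -> N2 -> M' -> 0], so that the horseshoe lemma bounds [N2]. *)
Lemma pdim_lt_coker d M' M M'' (i : {linear M' -> M}) (p : {linear M -> M''}) :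
  short_exact i p -> pdim_lt d M' -> pdim_lt d M -> pdim_lt d.+1 M''.
Proof.
case: d => [|d] [i_inj i_ex p_surj] M'd.
  move=> M0; apply: (pdim_ltS (d := 0)) => y.
  by have [x <-] := p_surj y; rewrite (M0 x) linear0.
case=> F [N [j [q [Fproj [j_inj j_ex q_surj] Nd]]]].
have jq0 a : q (j a) = 0 by apply/j_ex; exists a.
have ip0 a : p (i a) = 0 by apply/i_ex; exists a.
have [N2 [k [k_inj k_ex]]] := kernel_exists (p \o q).
have [|u uE] := factor_injective (f := j) k_inj.
  by move=> x; apply/k_ex; rewrite /= jq0 linear0.
have [|w wE] := factor_injective (f := q \o k) i_inj.
  by move=> x; apply/i_ex; apply/(k_ex (k x)); exists x.
exists F, N2, k, (p \o q); split=> //.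
  split=> // y; have [m <-] := p_surj y; have [x <-] := q_surj m.
  by exists x.
apply: (horseshoe (i := u) (p := w)) => //; last exact: pdim_ltS.
split.
- by move=> x y /(congr1 k); rewrite !uE => /j_inj.
- move=> c; split=> [wc0|[x <-]]; last first.
    by apply: i_inj; rewrite wE linear0 /= uE.
  have /j_ex[x xE] : q (k c) = 0 by have := wE c; rewrite wc0 linear0.
  by exists x; apply: k_inj; rewrite uE.
- move=> a; have [x xE] := q_surj (i a).
  have /k_ex[c cE] : (p \o q) x = 0 by rewrite /= xE.
  by exists c; apply: i_inj; rewrite wE /= cE.
Qed.

Lemma pdim_lt_le d M : pdim_lt d.+1 M -> pdim_le M d.
Proof.
suff: pdim_lt d.+1 M -> exists P : projective_resolution M,
    forall i, (d.+1 <= i)%N -> forall x : P i, x = 0 by [].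
move: d.+1 => {}d; elim: d M => [|d IHd] M.
  move=> /= M0.
  have ex : exact_at (idfun : {linear M -> M}) (idfun : {linear M -> M}).
    by move=> b; split=> [_|_]; [exists b | exact: M0].
  by exists (@ProjectiveResolution R M (fun=> M) (fun=> idfun) idfun
    (fun=> projective_zero M0) (fun b => ex_intro _ b erefl) ex (fun=> ex)).
case=> F [N [i [g [Fproj [i_inj i_ex g_surj] /IHd[P Pd]]]]].
pose Q k : lmodType R := if k is k'.+1 then P k' else F.
pose D k : {linear Q k.+1 -> Q k} :=
  if k is k'.+1 then res_diff P k' else i \o res_aug P.
have Qproj k : projective (Q k) by case: k => //= k; apply: res_projective.
have ex0 : exact_at (D 0%N) g.
  move=> b; split=> [/i_ex[a <-]|[c <-]].
    by have [c <-] := res_aug_surj P a; exists c.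
  by apply/i_ex; exists (res_aug P c).
have exS k : exact_at (D k.+1) (D k).
  case: k => [|k]; last exact: (@res_exactS _ _ P k).
  move=> b; split=> [|[c cE]] /=.
    by rewrite -(linear0 i) => /i_inj /(@res_exact0 _ _ P b).
  rewrite (_ : res_aug P b = 0) ?linear0 //.
  by apply/(@res_exact0 _ _ P b); exists c.
by exists (ProjectiveResolution Qproj g_surj ex0 exS) => -[|k] //= /Pd.
Qed.

End Homological.

(** * Cyclic modules *)

Section CyclicModules.
Local Open Scope ring_scope.
Local Open Scope quotient_scope.
Variable R : comNzRingType.
Implicit Types (S : R -> Prop) (a b f : R).

Lemma in_ideal_sum S (I : eqType) (r : seq I) (P : pred I) (F : I -> R) :
  (forall i, i \in r -> P i -> in_ideal S (F i)) ->
  in_ideal S (\sum_(i <- r | P i) F i).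
Proof.
move=> FS; rewrite big_seq_cond.
elim/big_ind: _ => [|x y|i /andP[]];
  [exact: in_ideal0 | exact: in_idealD | exact: FS].
Qed.

Lemma quot_pi_eq S a b :
  \pi_(quot_by S) a = \pi_(quot_by S) b <-> in_ideal S (a - b).
Proof.
split=> [/eqP|abS]; first by rewrite -Quotient.idealrBE => /in_idealP.
by apply/eqP; rewrite -Quotient.idealrBE; apply/in_idealP.
Qed.

Lemma quot_scaleE S a b : a *: \pi_(quot_by S) b = \pi_(quot_by S) (a * b).
Proof. exact: quot_scale_pi. Qed.

Lemma quot_mul S S' f : (forall a, in_ideal S a -> in_ideal S' (f * a)) ->
  exists h : {linear quot_by S -> quot_by S'},
    forall a, h (\pi_(quot_by S) a) = \pi_(quot_by S') (f * a).
Proof.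
move=> SS'.
pose h (x : quot_by S) : quot_by S' := \pi_(quot_by S') (f * repr x).
have hE a : h (\pi_(quot_by S) a) = \pi_(quot_by S') (f * a).
  apply/quot_pi_eq; rewrite -mulrBr; apply: SS'.
  by apply/quot_pi_eq; rewrite reprK.
have [|h' h'E] := linear_of (f := h); last by exists h' => a; rewrite h'E hE.
move=> a x y; rewrite -[x]reprK -[y]reprK quot_scaleE -quot_piD !hE.
by rewrite quot_scaleE -quot_piD mulrDr mulrCA.
Qed.

(** With [I] the ideal of [S], this is [0 -> R/(I : f) -> R/I -> R/(I + f) -> 0],
    whose first map is multiplication by [f]. *)
Lemma colon_exact S S1 S2 f :
  (forall a, in_ideal S1 a <-> in_ideal S (f * a)) ->
  (forall a, in_ideal S2 a <-> exists b, in_ideal S (a - f * b)) ->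
  exists (i : {linear quot_by S1 -> quot_by S})
         (p : {linear quot_by S -> quot_by S2}), short_exact i p.
Proof.
move=> colon sum.
have [|i iE] := @quot_mul S1 S f; first by move=> a /colon.
have [|p pE] := @quot_mul S S2 1.
  by move=> a aS; rewrite mul1r; apply/sum; exists 0; rewrite mulr0 subr0.
exists i, p; split.
- move=> x y; rewrite -[x]reprK -[y]reprK !iE => /quot_pi_eq.
  by rewrite -mulrBr => /colon ?; apply/quot_pi_eq.
- move=> x; rewrite -[x]reprK pE mul1r quot_pi_eq0 sum.
  split=> [[b bS]|[y]].
    by exists (\pi_(quot_by S1) b); rewrite iE; apply/esym/quot_pi_eq.
  rewrite -[y]reprK iE => /esym/quot_pi_eq yS; by exists (repr y).
- move=> y; exists (\pi_(quot_by S) (repr y)).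
  by rewrite pE mul1r reprK.
Qed.

End CyclicModules.

(** * Face rings of simplicial complexes *)

Section FaceRings.
Local Open Scope ring_scope.
Local Open Scope quotient_scope.
Variables (n : nat) (K : fieldType).
Local Notation R := {mpoly K[n]}.
Implicit Types (D : {set {set 'I_n}}) (m : 'X_{1..n}) (p q : R) (F : {set 'I_n}).

Definition mnm_supp m : {set 'I_n} := [set i | m i != 0%N].

Lemma mcoeffUM i p m : m i = 0%N -> ('X_i * p)@_m = 0.
Proof.
move=> mi0; apply/eqP; rewrite mcoeff_eq0 mulrC.
apply/negP; rewrite (perm_mem (msuppMX p U_(i))) => /mapP[k _ mE].
by move: mi0; rewrite mE mnmDE mnm1E eqxx.
Qed.

Lemma mcoeffUMD i p m : ('X_i * p)@_(U_(i) + m) = p@_m.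
Proof. by rewrite mulrC mcoeffMX. Qed.

Lemma mnm_suppD i m : mnm_supp (U_(i) + m) = i |: mnm_supp m.
Proof.
apply/setP=> j; rewrite !inE mnmDE mnm1E addn_eq0 negb_and eqb0 negbK (eq_sym j).
by [].
Qed.

Lemma mnm_subUK i m : i \in mnm_supp m -> (U_(i) + (m - U_(i)))%MM = m.
Proof.
rewrite inE => mi; apply/mnmP=> j; rewrite mnmDE mnmBE mnm1E.
by case: eqP => [<-|_] /=; rewrite ?subn0 // subnKC // lt0n.
Qed.

Lemma mpolyX_sum F :
  'X_[\sum_(i in F) U_(i)] = \prod_(i in F) 'X_i :> R.
Proof. exact: (big_morph _ (@mpolyXD n K) (mpolyX0 n K)). Qed.

Lemma in_ideal_monomial D m :
  mnm_supp m \notin D -> in_ideal (nonface_monomial D) ('X_[m] : R).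
Proof.
move=> mD.
have lem : (\sum_(i in mnm_supp m) U_(i) <= m)%MM.
  apply/mnm_lepP=> j; rewrite mnm_sumE.
  have [jm|jm] := boolP (j \in mnm_supp m).
    rewrite (bigD1 j) //= mnm1E eqxx big1 ?addn0.
      by rewrite inE lt0n in jm *.
    by move=> i /andP[_ /negPf ij]; rewrite mnm1E ij.
  rewrite big1 // => i im; rewrite mnm1E; case: eqP => // ij.
  by rewrite ij (negPf jm) in im.
rewrite -(submK lem) mpolyXD; apply/in_idealM/in_ideal_gen.
by exists (mnm_supp m); split=> //; rewrite mpolyX_sum.
Qed.

Definition down_closed D : Prop :=
  forall F G : {set 'I_n}, F \subset G -> G \in D -> F \in D.

(** A Stanley-Reisner ideal is spanned by the monomials whose support is not a
    face, so membership can be read off the coefficients; all ideal computations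
    below reduce to statements on supports. *)
Lemma in_nonface_idealP D p : down_closed D ->
  in_ideal (nonface_monomial D) p <-> forall m, mnm_supp m \in D -> p@_m = 0.
Proof.
move=> downD; split.
  case=> k [c [g [gD ->]]] m mD; rewrite raddf_sum big1 //= => l _.
  have [F [FD ->]] := gD l; rewrite -mpolyX_sum.
  apply/eqP; rewrite mcoeff_eq0; apply: contra FD.
  rewrite (perm_mem (msuppMX _ _)) => /mapP[m' _ mE].
  apply: downD mD; apply/subsetP=> i iF; rewrite inE mE mnmDE mnm_sumE.
  by rewrite (bigD1 i) //= mnm1E eqxx.
move=> p0; rewrite [p]mpolyE; apply: in_ideal_sum => m mp _.
rewrite -mul_mpolyC; apply/in_idealM/in_ideal_monomial.
by apply: contraTN mp => /p0/eqP; rewrite mcoeff_eq0.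
Qed.

(** For a complex [D] this is the closed star of [v], and its ideal is the colon of
    the ideal of [D] by the variable of [v]. *)
Definition star v D : {set {set 'I_n}} := [set F | v |: F \in D].
Definition deletion v D : {set {set 'I_n}} := [set F in D | v \notin F].

Lemma star_down v D : down_closed D -> down_closed (star v D).
Proof. by move=> dD F G FG; rewrite !inE; apply/dD/setUS. Qed.

Lemma deletion_down v D : down_closed D -> down_closed (deletion v D).
Proof.
move=> dD F G FG; rewrite !inE => /andP[/(dD _ _ FG) -> /=].
by apply: contra; apply: (subsetP FG).
Qed.

Lemma star_deletion_exact v D : down_closed D ->
  exists (i : {linear stanley_reisner_ring K (star v D)
                      -> stanley_reisner_ring K D})
         (p : {linear stanley_reisner_ring K D
                      -> stanley_reisner_ring K (deletion v D)}),
    short_exact i p.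
Proof.
move=> dD; apply: (colon_exact (f := 'X_v : R)) => a.
  rewrite (in_nonface_idealP _ (star_down dD)) (in_nonface_idealP _ dD).
  split=> a0 m.
    have [vm|vm _] := boolP (v \in mnm_supp m); last first.
      by apply: mcoeffUM; apply/eqP; rewrite inE negbK in vm.
    rewrite -(mnm_subUK vm) mcoeffUMD => mD.
    by apply: a0; rewrite inE -mnm_suppD.
  by rewrite inE -mnm_suppD => /a0; rewrite mcoeffUMD.
rewrite (in_nonface_idealP _ (deletion_down dD)); split=> [a0|[b]].
  (* The quotient of [a] by the variable, leaving the terms without it. *)
  exists (\sum_(m <- msupp a | v \in mnm_supp m) a@_m *: 'X_[m - U_(v)]).
  rewrite [a in a - _]mpolyE (bigID (fun m => v \in mnm_supp m)) /=.
  rewrite mulr_sumr addrAC -sumrB big1 ?add0r; last first.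
    by move=> m vm; rewrite -scalerAr -mpolyXD mnm_subUK ?subrr.
  apply: in_ideal_sum => m mp vm.
  rewrite -mul_mpolyC; apply/in_idealM/in_ideal_monomial.
  apply: contraTN mp => mD; rewrite -mcoeff_eq0; apply/eqP/a0.
  by rewrite inE mD.
move/(in_nonface_idealP _ dD) => ab0 m; rewrite inE => /andP[mD vm].
move: (ab0 _ mD); rewrite mcoeffB mcoeffUM ?subr0 //.
by apply/eqP; rewrite inE negbK in vm.
Qed.

(** When all sets are faces the ideal is zero and the face ring is free on the
    class of 1. *)
Lemma full_face_ring_projective D :
  (forall F, F \in D) -> projective (stanley_reisner_ring K D).
Proof.
move=> DT A B g f g_surj.
pose S := @nonface_monomial n K D.
have reprP (a : R) : repr (\pi_(quot_by S) a) = a.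
  apply/eqP; rewrite -subr_eq0; apply/eqP/mpolyP=> m; rewrite mcoeff0.
  have [|a0 _] := @in_nonface_idealP D (repr (\pi_(quot_by S) a) - a).
    by move=> F G _ _; apply: DT.
  by apply: a0; rewrite ?DT //; apply/quot_pi_eq; rewrite reprK.
have [a0 a0E] := g_surj (f (\pi_(quot_by S) 1)).
have [|h hE] :=
    linear_of (f := fun x : stanley_reisner_ring K D => repr x *: a0).
  move=> a x y /=; rewrite -[x]reprK -[y]reprK quot_scaleE -quot_piD !reprP.
  by rewrite scalerDl scalerA.
exists h => x; rewrite -[x](@reprK _ (quot_by S)) hE reprP.
rewrite linearZ /= a0E -linearZ /=.
by rewrite quot_scaleE mulr1.
Qed.

(** Each missing vertex [v] is a cone point of the simplex on [v |: C]: its star is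
    the whole simplex and its deletion is the simplex on [C]. *)
Lemma face_ring_powerset (C : {set 'I_n}) :
  pdim_lt (n - #|C|).+1 (stanley_reisner_ring K (powerset C)).
Proof.
have powD (A : {set 'I_n}) : down_closed (powerset A).
  by move=> F G FG; rewrite !inE; apply: subset_trans.
move nE: (n - #|C|)%N => d; elim: d C nE => [|d IHd] C nE.
  apply/pdim_lt_projective/full_face_ring_projective => F.
  have /eqP -> : C == setT.
    by rewrite eqEcard subsetT cardsT card_ord -subn_eq0 nE.
  by rewrite powersetT inE.
have [v vC] : exists v, v \notin C.
  apply/existsP; rewrite -negb_forall; apply/negP=> /forallP CT.
  move: nE; rewrite (_ : C = setT) ?cardsT ?card_ord ?subnn //.
  by apply/setP=> i; rewrite inE CT.
have starE : star v (powerset (v |: C)) = powerset (v |: C).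
  by apply/setP=> F; rewrite !inE subUset sub1set setU11.
have delE : deletion v (powerset (v |: C)) = powerset C.
  apply/setP=> F; rewrite !inE; apply/andP/idP=> [[FvC vF]|FC].
    apply/subsetP=> i iF; have := subsetP FvC _ iF.
    by rewrite !inE; case: eqP => // iv; rewrite -iv iF in vF.
  split; first exact: (subset_trans FC (subsetUr _ _)).
  by apply: contra vC; apply: (subsetP FC).
have vCd : pdim_lt d.+1 (stanley_reisner_ring K (powerset (v |: C))).
  by apply: IHd; rewrite cardsU1 vC /= add1n subnS nE.
have := star_deletion_exact v (powD (v |: C)); rewrite starE delE.
by case=> i [p /pdim_lt_coker]; apply.
Qed.

Lemma star_deletion_pdim v d D : down_closed D ->
  pdim_lt d (stanley_reisner_ring K (star v D)) ->
  pdim_lt d (stanley_reisner_ring K (deletion v D)) ->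
  pdim_lt d (stanley_reisner_ring K D).
Proof. by move=> /(star_deletion_exact v)[i [p ex]]; apply: horseshoe ex. Qed.

End FaceRings.

(** * Clique complexes of trees *)

Section Trees.
Variables (n : nat) (K : fieldType) (e : rel 'I_n).

Definition clique_complex (A : {set 'I_n}) : {set {set 'I_n}} :=
  [set F : {set 'I_n} | (F \subset A) && clique e F].

Lemma clique_sub (F G : {set 'I_n}) : F \subset G -> clique e G -> clique e F.
Proof.
move=> FG /forall_inP Gc; apply/forall_inP=> x xF; apply/forall_inP=> y yF.
by have /forall_inP := Gc x (subsetP FG x xF); apply; apply: (subsetP FG).
Qed.

Lemma clique_complex_down A : down_closed (clique_complex A).
Proof.
move=> F G FG; rewrite !inE => /andP[GA Gc].
by rewrite (subset_trans FG GA) (clique_sub FG Gc).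
Qed.

Lemma clique_complexE A : clique e A -> clique_complex A = powerset A.
Proof.
move=> Ac; apply/setP=> F; rewrite !inE; apply: andb_idr => FA.
exact: clique_sub FA Ac.
Qed.

Lemma glued_vertex (A B : {set 'I_n}) d :
  0 < d -> #|B| = d -> #|A :&: B| = d.-1 -> exists v, B :\: A = [set v].
Proof.
move=> d_gt0 Bd ABd; apply/cards1P; apply/eqP.
rewrite cardsD setIC ABd Bd.
by case: d d_gt0 {Bd ABd} => //= d _; rewrite subSnn.
Qed.

(** The last glued vertex [v] has star the simplex on [B], because nothing in
    [A :\: B] is adjacent to [v], and its deletion leaves the tree on [A]. *)
Lemma tree_pdim A ds : tree_on e A ds ->
  sorted geq ds -> all (fun d => 0 < d) ds ->
  pdim_lt (n - last 0 ds).+1 (stanley_reisner_ring K (clique_complex A)).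
Proof.
elim=> {A ds} [A d Ac <- _ _ /=|A B ds d trA IH Bc Bd ABd nadj].
  by rewrite clique_complexE //; apply: face_ring_powerset.
rewrite all_rcons last_rcons => ds_sort /andP[d_gt0 ds_pos].
have [v vE] := glued_vertex d_gt0 Bd ABd.
have /setDP[vB vA] : v \in B :\: A by rewrite vE set11.
have AvE : A :|: B = v |: A.
  rewrite -vE; apply/setP=> x; rewrite !inE.
  by case: (x \in A); case: (x \in B).
(* The sequence of a tree is not empty, so [last] does not take its default. *)
have [ds' d_last] : sorted geq ds /\ d <= last 0 ds.
  have : ds != [::] by case: (trA) => // ? ? [].
  by case: (ds) ds_sort => //= x s; rewrite rcons_path => /andP[].
apply: (star_deletion_pdim (v := v)) => //; first exact: clique_complex_down.
- rewrite (_ : star v _ = powerset B).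
    by rewrite -{1}Bd; apply: face_ring_powerset.
  apply/setP=> F; rewrite !inE; apply/andP/idP=> [[vFAB vFc]|FB].
    apply/subsetP=> x xF; apply: contraT => xB.
    have xA : x \in A.
      have := subsetP vFAB x; rewrite !inE xF orbT (negPf xB) orbF; exact.
    have xv : x != v by apply: contraNneq xB => ->.
    have := nadj x v; rewrite !inE xA xB vB vA => /(_ isT isT) /negP[].
    move/forall_inP: vFc => /(_ x); rewrite !inE xF orbT => /(_ isT).
    by move/forall_inP=> /(_ v); rewrite !inE eqxx => /(_ isT) /implyP; apply.
  have vFB : v |: F \subset B by rewrite subUset sub1set vB.
  by split; [exact: subset_trans vFB (subsetUr _ _)|exact: clique_sub vFB Bc].
- rewrite (_ : deletion v _ = clique_complex A).
    apply: pdim_lt_leq (IH ds' ds_pos).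
    by rewrite ltnS leq_sub2l.
  apply/setP=> F; rewrite !inE AvE.
  case Fc: (clique e F); rewrite ?andbF //= !andbT.
  apply/andP/idP=> [[FvA vF]|FA].
    apply/subsetP=> x xF; have := subsetP FvA _ xF.
    by rewrite !inE; case: eqP => // xv; rewrite -xv xF in vF.
  split; first exact: (subset_trans FA (subsetUr _ _)).
  by apply: contra vA; apply: (subsetP FA).
Qed.

End Trees.

(** * Variables form a regular sequence on projective modules *)

Section VariableSpan.
Local Open Scope ring_scope.
Variables (n : nat) (K : fieldType).
Local Notation R := {mpoly K[n]}.
Implicit Types (M N P : lmodType R) (t : {set 'I_n}).

(** The submodule [(x_i : i in t) M]; no quotient module is ever formed. *)
Definition var_span t M (x : M) : Prop :=
  exists c : 'I_n -> M, x = \sum_(i in t) ('X_i : R) *: c i.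

Lemma var_span0 t M : var_span t (0 : M).
Proof. by exists (fun=> 0); rewrite big1 // => i _; rewrite scaler0. Qed.

Lemma var_spanD t M (x y : M) :
  var_span t x -> var_span t y -> var_span t (x + y).
Proof.
move=> [c ->] [d ->]; exists (fun i => c i + d i).
by rewrite -big_split; apply: eq_bigr => i _; rewrite scalerDr.
Qed.

Lemma var_spanZ t M (a : R) (x : M) : var_span t x -> var_span t (a *: x).
Proof.
move=> [c ->]; exists (fun i => a *: c i); rewrite scaler_sumr.
by apply: eq_bigr => i _; rewrite !scalerA mulrC.
Qed.

Lemma var_spanB t M (x y : M) :
  var_span t x -> var_span t y -> var_span t (x - y).
Proof. by move=> tx ty; rewrite -scaleN1r; apply/var_spanD/var_spanZ. Qed.

Lemma var_span_lin t M N (f : {linear M -> N}) (x : M) :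
  var_span t x -> var_span t (f x).
Proof.
move=> [c ->]; exists (fun i => f (c i)); rewrite linear_sum.
by apply: eq_bigr => i _; rewrite linearZ.
Qed.

Lemma var_span_sum t M (I : eqType) (r : seq I) (F : I -> M) :
  (forall i, i \in r -> var_span t (F i)) -> var_span t (\sum_(i <- r) F i).
Proof.
move=> tF; rewrite big_seq.
elim/big_ind: _ => //; [exact: var_span0|exact: var_spanD].
Qed.

Lemma var_spanU1 t j M (x : M) : j \notin t ->
  var_span (j |: t) x <-> exists a b : M, x = 'X_j *: a + b /\ var_span t b.
Proof.
move=> jt; split=> [[c ->]|[a [b [-> [c ->]]]]].
  exists (c j), (\sum_(i in t) ('X_i : R) *: c i); rewrite big_setU1 //.
  by split=> //; exists c.
exists (fun i => if i == j then a else c i); rewrite big_setU1 //= eqxx.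
congr (_ + _); apply: eq_bigr => i it.
by case: eqP => // ij; rewrite -ij it in jt.
Qed.

Lemma var_span_polyP t (p : R) :
  var_span t (p : R^o) <-> forall m, [disjoint mnm_supp m & t] -> p@_m = 0.
Proof.
split=> [[c ->] m mt|p0].
  rewrite raddf_sum big1 //= => i it; apply: mcoeffUM; apply/eqP.
  by have := disjointFl mt it; rewrite inE => /negbFE.
rewrite [p]mpolyE; apply: var_span_sum => m mp.
have : ~~ [disjoint mnm_supp m & t].
  by apply: contraTN mp => /p0/eqP; rewrite mcoeff_eq0.
rewrite disjoint_sym disjoint_subset => /subsetPn[i it]; rewrite inE negbK => im.
have tX : var_span t ('X_[m] : R^o).
  exists (fun j => if j == i then 'X_[m - U_(i)] else 0).
  rewrite (bigD1 i) //= eqxx big1 ?addr0; last first.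
    by move=> j /andP[_ /negPf->]; rewrite scaler0.
  by rewrite -[in LHS](mnm_subUK im) mpolyXD.
have := var_spanZ (p@_m)%:MP tX.
by rewrite (_ : _ *: _ = (p@_m)%:MP * 'X_[m]) // mul_mpolyC.
Qed.

(** A projective module [P] is a retract of the free module on its own elements,
    where the claim can be checked on coefficients, that is in [R]; there it is a
    statement on supports of monomials. *)
Lemma projective_var_regular P t j (x : P) : projective P -> j \notin t ->
  var_span t (('X_j : R) *: x) -> var_span t x.
Proof.
move=> Pproj jt tjx.
have [|g gE] := linear_of
    (f := fun D : {freeg P / R} => fglift (fun y : P => y) D).
  have lift_add := @lift_is_additive R P P idfun.
  pose L : {additive {freeg P / R} -> P} := HB.pack (fglift (idfun : P -> P))
    (GRing.isAdditive.Build {freeg P / R} P _ lift_add).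
  have LE : fglift (fun y : P => y) =1 L by [].
  move=> a D E; rewrite !LE raddfD; congr (_ + _).
  rewrite (_ : a *: D = fgscale a D) // raddf_sum.
  rewrite -[D in RHS]freeg_sumE raddf_sum scaler_sumr.
  by apply: eq_bigr => z _; rewrite -!LE !liftU scalerA.
have g_surj : surjective_lin g.
  move=> y; exists << y >>.
  by rewrite gE liftU scale1r.
have [h hE] := Pproj _ _ g idfun g_surj.
rewrite -[x]hE; apply: var_span_lin.
rewrite -[h x]freeg_sumE; apply: var_span_sum => z _.
have : var_span t (coeff z (h x) : R^o).
  have [c hc] := var_span_lin h tjx.
  have : var_span t (('X_j * coeff z (h x) : R) : R^o).
    exists (fun i => coeff z (c i)).
    rewrite -coeffZ -linearZ hc raddf_sum; apply: eq_bigr => i _.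
    exact: coeffZ.
  move=> /var_span_polyP jc; apply/var_span_polyP => m mt.
  rewrite -(mcoeffUMD j); apply: jc; rewrite mnm_suppD.
  by rewrite -setI_eq0 setIUl setU_eq0 !setI_eq0 mt disjoints1 jt.
case=> c cE; exists (fun i => << (c i : R) *g z >>).
apply/eqP/freeg_eqP=> y; rewrite coeffU cE mulr_suml raddf_sum.
by apply: eq_bigr => i _; rewrite /= coeffZ coeffU mulrA.
Qed.

End VariableSpan.

(** * Elements killed by variables bound the projective dimension below *)

Section LowerBound.
Local Open Scope ring_scope.
Variables (n : nat) (K : fieldType).
Local Notation R := {mpoly K[n]}.
Variables (M : lmodType R) (P : projective_resolution M).
Implicit Types (t : {set 'I_n}).

(** [z] vanishes in [P k / (im d + (x_t) P k)].  For cycles modulo the variables,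
    being in this submodule means having zero class in
    [Tor_k (M, R / (x_i : i in t))]. *)
Definition boundary_mod_vars t k (z : P k) : Prop :=
  exists w : P k.+1, var_span t (z - res_diff P k w).

Lemma res_diff2 k (w : P k.+2) : res_diff P k (res_diff P k.+1 w) = 0.
Proof. by apply/(@res_exactS _ _ P k); exists w. Qed.

(** This says that [Tor_(k+1) (M, R / (x_i : i in t))] vanishes as soon as
    [#|t| <= k].  In the induction on [t] it comes from the long exact sequence of
    multiplication by one more variable [x_j], here unfolded into elements. *)
Lemma tor_vars_vanish t k (y : P k.+1) : (#|t| <= k)%N ->
  var_span t (res_diff P k y) -> boundary_mod_vars t y.
Proof.
move sE: #|t| => s; elim: s t sE k y => [|s IHs] t sE k y sk.
  move/eqP: sE; rewrite cards_eq0 => /eqP -> [c].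
  rewrite big_set0 => /(@res_exactS _ _ P k)[w wE].
  by exists w; rewrite wE subrr; apply: var_span0.
have /card_gt0P[j jt] : (0 < #|t|)%N by rewrite sE.
have := setD1K jt; move: (t :\ j) (cardsD1 j t) (setD11 j t) => t'.
rewrite jt sE => -[] /esym t's /negbT jt' <-.
case/(var_spanU1 _ jt') => a [b [dyE t'b]].
(* [s < k] leaves room for one more differential below [a]. *)
case: k => [//|k] in y sk a b dyE t'b *.
have t'da : var_span t' (res_diff P k a).
  apply: (projective_var_regular (j := j)) (jt') _; first exact: res_projective.
  have /eqP : res_diff P k ('X_j *: a + b) = 0 by rewrite -dyE res_diff2.
  rewrite linearD linearZ /= addr_eq0 => /eqP->; rewrite -scaleN1r.
  exact/var_spanZ/var_span_lin.
have [c ct] := IHs _ t's _ _ sk t'da.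
have [|w wt] := IHs _ t's k.+1 (y - 'X_j *: c) (leqW sk).
  rewrite linearB linearZ /= dyE addrAC -scalerBr.
  by apply: var_spanD => //; apply: var_spanZ.
exists w; apply/(var_spanU1 _ jt').
exists c, (y - 'X_j *: c - res_diff P k.+2 w); split=> //.
by rewrite addrA [_ + (y - _)]addrC subrK.
Qed.

(** Start from a lift of [x] to [P 0].  If [z] in [P s] is nonzero modulo
    boundaries and [s] variables but is killed by a further variable [x_j], write
    [x_j z = d w] modulo the [s] variables.  Then [w] in [P s.+1] is nonzero modulo
    boundaries and the [s.+1] variables, because [x_j] is regular; and it is again
    killed by all the variables: [x_i w] differs by a multiple of [x_j] from a
    cycle modulo the [s] variables, in a degree where [Tor] is zero. *)
Lemma tor_vars_nonzero (x : M) t :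
  x != 0 -> (forall j, j \in t -> ('X_j : R) *: x = 0) ->
  exists z : P #|t|, ~ boundary_mod_vars t z.
Proof.
move=> x0 tx.
suff H s : (s <= #|t|)%N ->
    exists2 t' : {set 'I_n}, t' \subset t & #|t'| = s /\
    exists z : P s, ~ boundary_mod_vars t' z /\
      forall j, j \in t -> boundary_mod_vars t' (('X_j : R) *: z).
  have [t' t't [t'E [z [zt _]]]] := H _ (leqnn _).
  have tE : t' = t by apply/eqP; rewrite eqEcard t't t'E /=.
  by move: z zt; rewrite tE => z zt; exists z.
elim: s => [_|s IHs st].
  exists set0; first exact: sub0set.
  split; first exact: cards0.
  have [z zE] := res_aug_surj P x.
  exists z; split=> [[w [c]]|j jt].
    rewrite big_set0 => /eqP; rewrite subr_eq0 => /eqP zw.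
    move/eqP: x0; apply; rewrite -zE zw.
    by apply/(@res_exact0 _ _ P); exists w.
  have /(@res_exact0 _ _ P)[w wE] : res_aug P (('X_j : R) *: z) = 0.
    by rewrite linearZ /= zE tx.
  by exists w; rewrite wE subrr; apply: var_span0.
have [t' t't [t'E [z [zt zj]]]] := IHs (ltnW st).
have [j jt jt'] : exists2 j, j \in t & j \notin t'.
  apply/subsetPn; apply: contraTN st => /subset_leq_card.
  by rewrite t'E -leqNgt.
have [w wt] := zj j jt.
exists (j |: t'); first by rewrite subUset sub1set jt.
split; first by rewrite cardsU1 jt' t'E.
exists w; split.
  case=> w' /(var_spanU1 _ jt')[a [b [wE bt]]]; apply: zt; exists a.
  apply: (projective_var_regular (j := j)) (jt') _; first exact: res_projective.
  have -> : 'X_j *: (z - res_diff P s a) =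
      ('X_j *: z - res_diff P s w) + res_diff P s b.
    have /(congr1 (res_diff P s)) := wE.
    rewrite linearB /= res_diff2 subr0 linearD linearZ /= => ->.
    by rewrite scalerBr opprD addrA subrK.
  by apply: var_spanD => //; apply: var_span_lin.
move=> i it; have [wi wit] := zj i it.
have [w' w't] : boundary_mod_vars t' ('X_i *: w - 'X_j *: wi).
  apply: tor_vars_vanish; first by rewrite t'E.
  have -> : res_diff P s ('X_i *: w - 'X_j *: wi) =
      'X_j *: ('X_i *: z - res_diff P s wi)
      - 'X_i *: ('X_j *: z - res_diff P s w).
    rewrite linearB [res_diff P s ('X_i *: w)]linearZ.
    rewrite [res_diff P s ('X_j *: wi)]linearZ /= !scalerBr !scalerA.
    by rewrite [('X_j * _ : R)]mulrC opprB [RHS]addrC addrA subrK.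
  by apply: var_spanB; apply: var_spanZ.
exists w'; apply/(var_spanU1 _ jt').
exists wi, ('X_i *: w - 'X_j *: wi - res_diff P s.+1 w'); split=> //.
by rewrite addrA [_ + (_ - _)]addrC subrK.
Qed.

End LowerBound.

Lemma annihilator_pdim (n : nat) (K : fieldType) (M : lmodType {mpoly K[n]})
    (t : {set 'I_n}) (x : M) d :
  x != 0%R -> (forall j, j \in t -> ('X_j *: x = 0)%R) ->
  pdim_le M d -> #|t| <= d.
Proof.
move=> x0 tx [P Pd]; rewrite leqNgt; apply/negP=> dt.
have [z] := tor_vars_nonzero P x0 tx; apply.
exists 0%R; rewrite (Pd _ dt z) linear0 subrr; exact: var_span0.
Qed.

(** * Degrees and projective dimension *)

Section FinalBounds.
Variables (n : nat) (K : fieldType) (e : rel 'I_n).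
Local Open Scope quotient_scope.

Lemma independence_clique_complex : irreflexive e ->
  independence_complex e = clique_complex (compl_graph e) [set: 'I_n].
Proof.
move=> e_irr; apply/setP=> F; rewrite !inE subsetT /=.
apply: eq_forallb_in => x xF; apply: eq_forallb_in => y yF /=.
by rewrite /compl_graph /=; case: eqVneq => [<-|_]; rewrite ?e_irr.
Qed.

(** The class of the variable of [v] is killed by those of the neighbours. *)
Lemma degree_le_pdim v d : irreflexive e ->
  pdim_le (stanley_reisner_ring K (independence_complex e)) d ->
  degree e v <= d.
Proof.
move=> e_irr; pose S := @nonface_monomial n K (independence_complex e).
have dD : down_closed (independence_complex e).
  by rewrite independence_clique_complex //; apply: clique_complex_down.
apply: (annihilator_pdim (x := \pi_(quot_by S) ('X_v)%R)) => [|j].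
  apply/eqP=> /quot_pi_eq0/(in_nonface_idealP _ dD)/(_ U_(v)%MM).
  rewrite mcoeffXU eqxx => v0.
  suff /v0/eqP : mnm_supp U_(v) \in independence_complex e.
    by rewrite oner_eq0.
  rewrite inE; apply/forall_inP=> x; rewrite inE mnm1E eqb0 negbK => /eqP <-.
  apply/forall_inP=> y; rewrite inE mnm1E eqb0 negbK => /eqP <-.
  by rewrite e_irr.
rewrite inE => evj; rewrite quot_scaleE; apply/quot_pi_eq0.
rewrite -mpolyXD; apply: in_ideal_monomial; rewrite mnm_suppD inE.
apply/negP=> /forall_inP/(_ v); rewrite !inE mnm1E eqxx orbT => /(_ isT).
by move=> /forall_inP/(_ j); rewrite setU11 evj => /(_ isT).
Qed.

(** The vertex glued last is adjacent, in the graph [e], to all vertices outside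
    the last clique [B]. *)
Lemma tree_le_max_degree ds : ssrbool.symmetric e -> all (fun d => 0 < d) ds ->
  is_tree (compl_graph e) ds -> n - last 0 ds <= \max_(i < n) degree e i.
Proof.
move=> e_sym; rewrite /is_tree; move AE: [set: 'I_n] => A ds_pos tr.
case: tr AE ds_pos => {A ds} [A d _ <- <- _|A B ds d _ _ Bd ABd nadj ABE].
  by rewrite /= cardsT card_ord subnn.
rewrite all_rcons last_rcons => /andP[d_gt0 _].
have [v vE] := glued_vertex d_gt0 Bd ABd.
have vB : v \in B :\: A by rewrite vE set11.
apply: leq_trans (leq_bigmax v).
rewrite -Bd -[n in n - _]card_ord -(cardsC B) addKn.
apply: subset_leq_card; apply/subsetP=> y; rewrite !inE => yB.
have yA : y \in A :\: B.
  by move: (in_setT y); rewrite ABE !inE (negPf yB) orbF.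
have := nadj y v yA vB; rewrite negb_and !negbK e_sym => /orP[/eqP yv|//].
by move: yB; rewrite yv; case/setDP: vB => ->.
Qed.

End FinalBounds.

Theorem theorem5p4 (K : fieldType) (n : nat) (e : rel 'I_n)
    (e_sym : ssrbool.symmetric e) (e_irr : irreflexive e)
    (e_conn : connected_graph e)
    (ds : seq nat)
    (ds_noninc : sorted geq ds) (ds_pos : all (fun d => 0 < d) ds)
    (e_tree : is_tree (compl_graph e) ds) :
  pdim_eq (stanley_reisner_ring K (independence_complex e))
          (\max_(i < n) degree e i).
Proof.
split=> [|d Md]; last by apply/bigmax_leqP => i _; apply: degree_le_pdim Md.
apply: pdim_lt_le; rewrite independence_clique_complex //.
apply: pdim_lt_leq (tree_pdim K e_tree ds_noninc ds_pos).
by rewrite ltnS; apply: tree_le_max_degree.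
Qed.
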